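(* Let $(X,d)$ be a compact metric space, let $\mu_1,\mu_{-1}\in\mathscr{P}(X)$, and for $i=\pm1$ let $l_i:\mathbb{R}\to\mathbb{R}_+$ be convex and let $c_i:X\times X\to\mathbb{R}_+\cup\{+\infty\}$ be lower semicontinuous with $c_i(x,x)=0$ for every $x\in X$. Then $$\inf_{h\in C(X)}\ \sup_{(\gamma_1,\gamma_{-1})\in\Delta_{\mu_1,\mu_{-1}}} J(h,\gamma_1,\gamma_{-1})=\sup_{(\gamma_1,\gamma_{-1})\in\Delta_{\mu_1,\mu_{-1}}}\ \inf_{h\in C(X)} J(h,\gamma_1,\gamma_{-1})=\max_{(\gamma_1,\gamma_{-1})\in\Delta_{\mu_1,\mu_{-1}}}\ \inf_{h\in C(X)} J(h,\gamma_1,\gamma_{-1}),$$ where the $\max$ means that the supremum over $\Delta_{\mu_1,\mu_{-1}}$ is attained.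
   Context: $\mathbb{R}_+=[0,+\infty)$. $\mathscr{P}(X)$ (resp. $\mathscr{P}(X\times X)$) is the set of Borel probability measures on $X$ (resp. $X\times X$) and $C(X)$ the set of continuous real-valued functions on $X$. With $\mathrm{proj}_1(x,z)=x$ and $_\#$ denoting pushforward of measures, $$\Delta_{\mu_1,\mu_{-1}}:=\{(\gamma_1,\gamma_{-1})\in\mathscr{P}(X\times X)^2:\ {\mathrm{proj}_1}_\#\gamma_i=\mu_i,\ i=\pm1\}.$$ For $h\in C(X)$ and $(\gamma_1,\gamma_{-1})\in\Delta_{\mu_1,\mu_{-1}}$, $$J(h,\gamma_1,\gamma_{-1}):=\sum_{i=\pm1}\int_{X\times X}[\,l_i(h(z))-c_i(x,z)\,]\,\mathrm{d}\gamma_i(x,z)\in[-\infty,+\infty).$$ *)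

(* Defs.v *)
From HB Require Import structures.
From mathcomp Require Import all_boot all_order all_algebra.
From mathcomp Require Import all_classical all_reals all_analysis.

Set Implicit Arguments.
Unset Strict Implicit.
Unset Printing Implicit Defensive.

Import Order.TTheory GRing.Theory Num.Theory.
Import numFieldNormedType.Exports.

Local Open Scope classical_set_scope.
Local Open Scope ring_scope.

(* Measurable spaces are pointed in this library.  A space that carries a
   probability measure is nonempty, so a base point costs no generality. *)
#[short(type="pmetricType")]
HB.structure Definition PointedMetric (K : numDomainType) :=
  {M of Metric K M & isPointed M}.

Notation borel T := (g_sigma_algebraType (@open T%type)).

(* The Borel sigma-algebra on X * X is that of the product topology, not
   the product sigma-algebra (the two agree when X is compact). *)
Notation borel_probability R T := (probability (borel T) R).

(* The suffixes 1 and m1 stand for the indices 1 and -1; gamma is the pair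
   (gamma_1, gamma_{-1}). *)
Section minimax.
Context (R : realType) (X : pmetricType R).
Local Open Scope ereal_scope.

Local Notation P T := (borel_probability R T).

(* [pushforward] is also defined on non-measurable sets, where it carries no
   meaning: equality of measures is equality on Borel sets. *)
Definition first_marginal (gamma : P (X * X)) (mu : P X) : Prop :=
  forall A : set (borel X), measurable A ->
    pushforward gamma (fst : borel (X * X) -> borel X) A = mu A.

Definition Delta (mu1 mum1 : P X) : set (P (X * X) * P (X * X)) :=
  [set gamma : (P (X * X) * P (X * X))%type |
    first_marginal gamma.1 mu1 /\ first_marginal gamma.2 mum1].

Definition Cfun : set (X -> R) := [set h | continuous h].

(* The integral of an extended real-valued function is the difference of the
   integrals of its positive and negative parts.  When h is continuous, the
   l's are convex and the c's nonnegative on a compact X, the positive part is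
   bounded, so both integrals lie in [-oo, +oo[ and oo - oo does not occur. *)
Definition J (l1 lm1 : R -> R) (c1 cm1 : X * X -> \bar R)
    (h : X -> R) (gamma : P (X * X) * P (X * X)) : \bar R :=
  \int[gamma.1]_p ((l1 (h p.2))%:E - c1 p) +
  \int[gamma.2]_p ((lm1 (h p.2))%:E - cm1 p).

End minimax.

Arguments Cfun {R} X.

(* Main.v *)
Require Import Defs.
From HB Require Import structures.
From mathcomp Require Import all_boot all_order all_algebra.
From mathcomp Require Import all_classical all_reals all_analysis.
From mathcomp Require Import measurable_realfun.
From mathcomp Require Import ring lra.

(** Weak duality (sup inf <= inf sup) is formal, so with V the value of
    inf sup, everything follows from one pair of couplings g in Delta with
    V <= J h g for every continuous h.

    Such a pair comes from compactness.  For h continuous and v < V real, let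
    A(h, v) be the set of pairs g of Delta with v < J h g.  Finitely many of
    these sets always meet: J is convex in h and affine in g, so if A(h_1, v_1),
    ..., A(h_n, v_n) had no common point, the alternative
    [convex_concave_alternative] would give a continuous h and a v < V with
    J h <= v on all couplings of finite cost, hence on Delta (elsewhere J is
    -oo), contradicting the definition of V.  Hence some ultrafilter U on pairs
    contains all the sets A(h, v).

    Along U the measures have a weak limit [weak_limit_exists]: the limit along
    U of the masses of Borel sets is a finitely additive probability, and on a
    compact metric space a finitely additive probability L yields a Borel
    probability that is at most L on open sets [borel_probability_of_content].
    This one-sided bound is the portmanteau inequality.  It is enough to see
    that marginals pass to the limit [first_marginal_weak_limit] and that
    integrals of nonnegative lower semicontinuous functions are lower
    semicontinuous along U [weak_limit_integral_lsc].

    If M bounds l (h z), the integrand l (h z) - c (x, z) is M minus a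
    nonnegative lower semicontinuous function, so each J h is upper
    semicontinuous along U: a limit pair with J h g < V would give real v with
    J h < v < V near U, while A(h, v) belongs to U. *)

Set Implicit Arguments.
Unset Strict Implicit.
Unset Printing Implicit Defensive.

Import Order.TTheory GRing.Theory Num.Theory.
Import numFieldNormedType.Exports.
Import HBNNSimple.

Local Open Scope classical_set_scope.
Local Open Scope ring_scope.

(** * A finite convex-concave alternative *)

(** The pairs (f p, g p) form a set, convex up to domination, that misses the
    open positive quadrant of the plane; the weights are the normal of a line
    separating the two.  Points with g > 0 bound t from below, points with
    f > 0 bound it from above, and t is the supremum of the lower bounds. *)
Lemma concavelike_pair_weight (R : realType) (T : Type) (D : set T)
  (f g : T -> R)
  (mix : forall p q s, D p -> D q -> 0 <= s <= 1 -> exists2 r, D r &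
     s * f p + (1 - s) * f q <= f r /\ s * g p + (1 - s) * g q <= g r)
  (le0 : forall p, D p -> f p <= 0 \/ g p <= 0) :
  exists2 t, 0 <= t <= 1 & forall p, D p -> t * f p + (1 - t) * g p <= 0.
Proof.
(* Each lower bound for t is below each upper bound: otherwise the segment
   from p to q meets the open positive quadrant. *)
have cross p q : D p -> D q -> 0 < f p -> 0 < g q ->
    g q * f p <= g p * f q.
  move=> Dp Dq fp gq; rewrite leNgt; apply/negP => lt_cross.
  have gp : g p <= 0 by case: (le0 _ Dp) => //; lra.
  have fq : f q <= 0 by case: (le0 _ Dq) => //; lra.
  (* s = al / (al + be) makes both combinations equal to the positive number
     (g q * f p - g p * f q) / (al + be). *)
  set al := g q - f q; set be := f p - g p.
  have al0 : 0 < al by rewrite /al; lra.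
  have be0 : 0 < be by rewrite /be; lra.
  have ab0 : al + be != 0 by rewrite gt_eqF// addr_gt0.
  have s01 : 0 <= al / (al + be) <= 1.
    by apply/andP; split; [rewrite divr_ge0//; lra|rewrite ler_pdivrMr; lra].
  have onem : 1 - al / (al + be) = be / (al + be) by field.
  have [r Dr [fr gr]] := mix p q _ Dp Dq s01.
  have fE : al / (al + be) * f p + be / (al + be) * f q =
      (g q * f p - g p * f q) / (al + be).
    by rewrite /al /be in ab0 *; field.
  have gE : al / (al + be) * g p + be / (al + be) * g q =
      (g q * f p - g p * f q) / (al + be).
    by rewrite /al /be in ab0 *; field.
  have pos : 0 < (g q * f p - g p * f q) / (al + be).
    by apply: divr_gt0; lra.
  rewrite onem fE in fr; rewrite onem gE in gr.
  by case: (le0 _ Dr); rewrite leNgt => /negP; apply; apply: lt_le_trans pos _.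
pose A := [set t : R | t = 0 \/ exists q, [/\ D q, 0 < g q &
  t = g q / (g q - f q)]].
have fneg q : D q -> 0 < g q -> f q <= 0.
  by move=> Dq gq; case: (le0 _ Dq) => //; rewrite leNgt gq.
have A1 : ubound A 1.
  move=> _ [->//|[q [Dq gq ->]]]; have := fneg _ Dq gq => fq.
  by rewrite ler_pdivrMr; lra.
have A0 : A 0 by left.
have supA : has_sup A by split; [exists 0|exists 1].
have t0 : 0 <= sup A by apply: ub_le_sup => //; exists 1.
have t1 : sup A <= 1 by apply: ge_sup => //; exists 0.
exists (sup A); first by rewrite t0.
move=> p Dp; have [gp|gp] := ltP 0 (g p).
  have fp := fneg _ Dp gp.
  have : g p / (g p - f p) <= sup A.
    by apply: ub_le_sup; [exists 1|right; exists p].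
  by rewrite ler_pdivrMr; lra.
have [fp|fp] := ltP 0 (f p); last by nra.
suff : sup A <= - g p / (f p - g p) by rewrite ler_pdivlMr; lra.
apply: ge_sup; first by exists 0.
move=> _ [->|[q [Dq gq ->]]]; first by rewrite divr_ge0//; lra.
have fq := fneg _ Dq gq.
have := cross _ _ Dp Dq fp gq.
rewrite ler_pdivrMr; last lra.
rewrite mulrAC ler_pdivlMr; last lra.
by move=> ?; nra.
Qed.

(** A minimax argument in the manner of Kneser.  The finite family is shortened
    one function at a time: restricting to the points where F a is positive
    keeps the domain concave-like, and the function b found there is combined
    with a by [concavelike_pair_weight]. *)
Lemma convex_concave_alternative (R : realType) (I : eqType) (T : Type)
  (F : I -> T -> R) (C : set I) (i0 : I) (s : seq I) (D : set T)
  (Ci0 : C i0) (sC : {in s, forall i, C i})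
  (Fconvex : forall i j t, C i -> C j -> 0 <= t <= 1 -> exists2 k, C k &
     forall p, D p -> F k p <= t * F i p + (1 - t) * F j p)
  (Fconcave : forall p q t, D p -> D q -> 0 <= t <= 1 -> exists2 r, D r &
     forall i, C i -> t * F i p + (1 - t) * F i q <= F i r)
  (no_pos : forall p, D p -> exists2 i, i \in s & F i p <= 0) :
  exists2 i, C i & forall p, D p -> F i p <= 0.
Proof.
elim: s D sC Fconvex Fconcave no_pos => [|a s IHs] D sC Fconvex Fconcave no_pos.
  by exists i0 => // p /no_pos[].
have Ca : C a by apply: sC; rewrite mem_head.
pose D' := [set p | D p /\ 0 < F a p].
have [||||b Cb bD'] := IHs D'.
- by move=> i si; apply: sC; rewrite inE si orbT.
- move=> i j t Ci Cj t01; have [k Ck Fk] := Fconvex _ _ _ Ci Cj t01.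
  by exists k => // p [Dp _]; exact: Fk.
- move=> p q t [Dp ap] [Dq aq] t01; have [r Dr Fr] := Fconcave _ _ _ Dp Dq t01.
  exists r => //; split => //; apply: lt_le_trans (Fr _ Ca).
  by case/andP: t01 => t0 t1; nra.
- move=> p [Dp ap]; have [i] := no_pos _ Dp.
  rewrite inE => /predU1P[->|si Fi]; first by rewrite leNgt ap.
  by exists i.
have [|p Dp|t t01 Ft] := @concavelike_pair_weight R T D (F b) (F a).
- move=> p q t Dp Dq t01; have [r Dr Fr] := Fconcave _ _ _ Dp Dq t01.
  by exists r => //; split; exact: Fr.
- have [ap|ap] := leP (F a p) 0; first by right.
  by left; apply: bD'.
have [k Ck Fk] := Fconvex _ _ _ Cb Ca t01.
by exists k => // p Dp; apply: le_trans (Fk _ Dp) (Ft _ Dp).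
Qed.

(** * Borel measurability *)

Lemma continuous_borel_measurable (S T : ptopologicalType) (f : S -> T) :
  continuous f -> measurable_fun [set: borel S] (f : borel S -> borel T).
Proof.
move=> cf; apply: (@measurability _ _ (borel S) (borel T) _ _ (@open T)) => //.
move=> _ [V oV <-]; rewrite setTI; apply: sub_sigma_algebra.
by apply: open_comp => // x _; exact: cf.
Qed.

Lemma lower_semicontinuous_borel (R : realType) (K : ptopologicalType)
    (f : K -> \bar R) : lower_semicontinuous f ->
  measurable_fun [set: borel K] (f : borel K -> \bar R).
Proof.
move=> scif; apply: (measurability _ (ErealGenOInfty.measurableE R)).
move=> /= _ [_ [a ->]] <-; apply: measurableI => //; apply: sub_sigma_algebra.
by rewrite preimage_itvoy; move/lower_semicontinuousP : scif; exact.
Qed.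

Lemma integral_cst_probability (d : measure_display) (T : measurableType d)
  (R : realType) (P : probability T R) (r : R) : (\int[P]_x r%:E = r%:E)%E.
Proof. by rewrite integral_cst// [X in (_ * X)%E]probability_setT mule1. Qed.

(** * From finitely additive to countably additive probabilities *)

Section regular_content.
Context (R : realType) (K : ptopologicalType) (L : set K -> R).
Hypothesis compactK : compact [set: K].
Hypothesis normalK : normal_space K.
Hypothesis L_ge0 : forall A : set (borel K), measurable A -> 0 <= L A.
Hypothesis LT : L setT = 1.
Hypothesis L_add : forall A B : set (borel K), measurable A -> measurable B ->
  A `&` B = set0 -> L (A `|` B) = L A + L B.

Let L0 : L set0 = 0.
Proof.
have := @L_add set0 set0 measurable0 measurable0 (setI0 _).
by rewrite setU0; lra.
Qed.

Let closed_measurable (A : set (borel K)) : closed A -> measurable A.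
Proof.
move=> cA; rewrite -[A]setCK; apply: measurableC.
by apply: sub_sigma_algebra; exact: closed_openC.
Qed.

Let le_L (A B : set (borel K)) : measurable A -> measurable B ->
  A `<=` B -> L A <= L B.
Proof.
move=> mA mB AB; have mBA := measurableD mB mA.
rewrite -(setDUK AB) L_add//; last by rewrite setDIK.
by rewrite lerDl L_ge0.
Qed.

Let L_subadd (A B : set (borel K)) : measurable A -> measurable B ->
  L (A `|` B) <= L A + L B.
Proof.
move=> mA mB; have mBA := measurableD mB mA.
have -> : A `|` B = A `|` (B `\` A).
  by rewrite setUDr setDv setD0.
rewrite L_add//; last by rewrite setDIK.
by rewrite lerD2l le_L.
Qed.

Local Open Scope ereal_scope.

Definition inner_content (U : set K) : \bar R :=
  ereal_sup [set (L F)%:E | F in [set F | closed F /\ F `<=` U]].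

Definition outer_content (A : set K) : \bar R :=
  ereal_inf [set inner_content U | U in [set U | open U /\ A `<=` U]].

Lemma inner_content_ge U F : closed F -> F `<=` U ->
  (L F)%:E <= inner_content U.
Proof. by move=> cF FU; apply: ereal_sup_ubound; exists F. Qed.

Lemma inner_content_ge0 U : 0 <= inner_content U.
Proof.
rewrite -[leLHS]/(0%R%:E) -L0; apply: inner_content_ge; first exact: closed0.
exact: sub0set.
Qed.

Lemma le_inner_content U V : U `<=` V -> inner_content U <= inner_content V.
Proof.
move=> UV; apply: ge_ereal_sup => _ [F [cF FU] <-].
by apply: inner_content_ge => //; exact: subset_trans UV.
Qed.

Lemma inner_contentT : inner_content setT = 1.
Proof.
apply/eqP; rewrite eq_le; apply/andP; split.
  apply: ge_ereal_sup => _ [F [cF _] <-].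
  rewrite lee_fin -LT; apply: le_L => //; exact: closed_measurable.
rewrite -[leLHS]/(1%R%:E) -LT; apply: inner_content_ge => //; exact: closedT.
Qed.

(** Normality separates the disjoint closed sets F `\` U and F `\` V; each
    piece of F avoids one of the separating neighbourhoods. *)
Lemma closed_split (F U V : set K) : closed F -> open U -> open V ->
  F `<=` U `|` V -> exists F1 F2, [/\ closed F1, closed F2, F1 `<=` U,
    F2 `<=` V & F = F1 `|` F2].
Proof.
move=> cF oU oV FUV.
have closed_setD (W : set K) : open W -> closed (F `\` W).
  by move=> oW; rewrite setDE; apply: closedI => //; exact: open_closedC.
have FUFV : (F `\` U) `&` (F `\` V) = set0.
  by rewrite -subset0 => x [[Fx Ux] [_ Vx]]; case: (FUV _ Fx).
have [U' [V' [oU' oV' FU' FV' UV']]] :=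
  (@normal_openP R K).1 normalK _ _ (closed_setD _ oU) (closed_setD _ oV)
    FUFV.
exists (F `\` U'), (F `\` V'); split.
- exact: closed_setD.
- exact: closed_setD.
- by move=> x [Fx U'x]; apply: contrapT => Ux; apply: U'x; exact: FU'.
- by move=> x [Fx V'x]; apply: contrapT => Vx; apply: V'x; exact: FV'.
- by rewrite -setDIr UV' setD0.
Qed.

Lemma inner_contentU U V : open U -> open V ->
  inner_content (U `|` V) <= inner_content U + inner_content V.
Proof.
move=> oU oV; apply: ge_ereal_sup => _ [F [cF FUV] <-].
have [F1 [F2 [cF1 cF2 F1U F2V ->]]] := closed_split cF oU oV FUV.
apply: (@le_trans _ _ (L F1 + L F2)%:E).
  by rewrite lee_fin; apply: L_subadd; exact: closed_measurable.
by rewrite EFinD leeD// inner_content_ge.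
Qed.

(** Countable additivity enters here: a closed subset of the union is compact,
    so it already lies in a finite union, where [inner_contentU] applies. *)
Lemma inner_content_bigcup (U : (set K)^nat) : (forall n, open (U n)) ->
  inner_content (\bigcup_n U n) <= \sum_(n <oo) inner_content (U n).
Proof.
move=> oU; apply: ge_ereal_sup => _ [F [cF FU] <-].
have : compact F by exact: subclosed_compact compactK _.
rewrite compact_cover => /(_ _ setT U (fun n _ => oU n) FU) [D _ FD].
pose n := (\max_(i <- finmap.enum_fset D) i).+1.
have Fn : F `<=` \big[setU/set0]_(i < n) U i.
  move=> x /FD [i iD Uix]; rewrite -bigcup_mkord; exists i => //=.
  by rewrite /n ltnS; apply: leq_bigmax_seq.
apply: le_trans (nneseries_lim_ge n _); last first.
  by move=> i _ _; exact: inner_content_ge0.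
apply: le_trans (inner_content_ge cF Fn) _.
rewrite big_mkord.
elim: (n) => [|m IHm].
  rewrite !big_ord0; apply: ge_ereal_sup => _ [G [_ G0] <-].
  by move: G0; rewrite subset0 => ->; rewrite L0.
rewrite !big_ord_recr/=; apply: le_trans (inner_contentU _ (oU _)) _.
  by rewrite -bigcup_mkord; apply: bigcup_open => i _; exact: oU.
by rewrite leeD2r.
Qed.

Lemma outer_content_open U : open U -> outer_content U = inner_content U.
Proof.
move=> oU; apply/eqP; rewrite eq_le; apply/andP; split.
  by apply: ereal_inf_lbound; exists U => //; split => //; exact: subset_refl.
by apply: le_ereal_inf_tmp => _ [V [oV UV] <-]; exact: le_inner_content.
Qed.

Lemma outer_content_le A U : open U -> A `<=` U ->
  outer_content A <= inner_content U.
Proof. by move=> oU AU; apply: ereal_inf_lbound; exists U. Qed.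

Let outer_content_ge0 A : 0 <= outer_content A.
Proof.
by apply: le_ereal_inf_tmp => _ [V [oV UV] <-]; exact: inner_content_ge0.
Qed.

Let outer_content0 : outer_content set0 = 0.
Proof.
rewrite (outer_content_open open0); apply/eqP.
rewrite eq_le inner_content_ge0 andbT.
apply: ge_ereal_sup => _ [G [_ G0] <-].
by move: G0; rewrite subset0 => ->; rewrite L0.
Qed.

Let le_outer_content : {homo outer_content : A B / A `<=` B >-> A <= B}.
Proof.
move=> A B AB; apply: le_ereal_inf_tmp => _ [V [oV UV] <-].
by apply: outer_content_le => //; exact: subset_trans UV.
Qed.

Let outer_content_fin_num A : outer_content A \is a fin_num.
Proof.
rewrite ge0_fin_numE ?outer_content_ge0//.
rewrite (le_lt_trans (outer_content_le openT (@subsetT _ A)))//.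
by rewrite inner_contentT ltry.
Qed.

Let outer_content_sigma_subadditive : sigma_subadditive outer_content.
Proof.
move=> A; apply/lee_addgt0Pr => e e0.
have /choice[U AU] : forall n, exists V, [/\ open V, A n `<=` V &
    inner_content V <= outer_content (A n) + (e / (2 ^ n.+1)%:R)%:E].
  move=> n.
  have en : (0 < e / (2 ^ n.+1)%:R)%R by rewrite divr_gt0// ltr0n expn_gt0.
  have [_ [V [oV AV] <-] /ltW Ve] :=
    lb_ereal_inf_adherent en (outer_content_fin_num (A n)).
  by exists V.
have oU n : open (U n) by have [] := AU n.
have AUU : \bigcup_n A n `<=` \bigcup_n U n.
  by apply: subset_bigcup => n _; have [] := AU n.
apply: le_trans (outer_content_le (bigcup_open (fun n _ => oU n)) AUU) _.
apply: le_trans (inner_content_bigcup oU) _.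
apply: le_trans (epsilon_trick _ _ (ltW e0)) => //.
by apply: lee_nneseries => n *; [exact: inner_content_ge0|have [] := AU n].
Qed.

HB.instance Definition _ := isOuterMeasure.Build R K outer_content
  outer_content0 outer_content_ge0 le_outer_content
  outer_content_sigma_subadditive.

(** For V open containing A, exhaust V `&` U by a closed F, then the open set
    V `\` F, which contains A `\` U, by a closed G: F and G are disjoint closed
    subsets of V, so L F + L G is at most the inner content of V. *)
Lemma open_caratheodory U : open U ->
  caratheodory_measurable (outer_content : {outer_measure set K -> \bar R}) U.
Proof.
move=> oU; apply: le_caratheodory_measurable => A.
apply: le_ereal_inf_tmp => _ [V [oV AV] <-].
rewrite -leeBrDr ?outer_content_fin_num//.
apply: (@le_trans _ _ (inner_content (V `&` U))).
  by apply: outer_content_le; [exact: openI|exact: setSI].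
apply: ge_ereal_sup => _ [F [cF FVU] <-].
rewrite leeBrDr ?outer_content_fin_num// addeC -leeBrDr//.
apply: (@le_trans _ _ (inner_content (V `\` F))).
  apply: outer_content_le.
    by rewrite setDE; apply: openI => //; exact: closed_openC.
  by move=> x [/AV Vx Ux]; split => // /FVU [].
apply: ge_ereal_sup => _ [G [cG GVF] <-].
rewrite leeBrDr// -EFinD addrC.
apply: (@le_trans _ _ (L (F `|` G))%:E).
  rewrite lee_fin L_add//; [exact: closed_measurable|exact: closed_measurable|].
  by rewrite -subset0 => x [Fx /GVF []].
apply: inner_content_ge; first exact: closedU.
by move=> x [/FVU[]//|/GVF[]].
Qed.

Lemma borel_caratheodory (A : set (borel K)) : measurable A ->
  caratheodory_measurable (outer_content : {outer_measure set K -> \bar R}) A.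
Proof.
move=> mA; pose T := caratheodory_type
  (outer_content : {outer_measure set K -> \bar R}).
suff : <<s @open K >> `<=` (measurable : set (set T)) by exact.
apply: smallest_sub; first exact: sigma_algebra_measurable.
exact: open_caratheodory.
Qed.

Let borel_measure := outer_content : set (borel K) -> \bar R.

Let borel_measure_sigma_additive : semi_sigma_additive borel_measure.
Proof.
move=> F mF tF mUF.
apply: (@caratheodory_measure_sigma_additive _ _
  (outer_content : {outer_measure set K -> \bar R})) => //.
  by move=> n; exact: borel_caratheodory.
exact: borel_caratheodory.
Qed.

HB.instance Definition _ := isMeasure.Build _ (borel K) R borel_measure
  outer_content0 outer_content_ge0 borel_measure_sigma_additive.

Let borel_measureT : borel_measure setT = 1.
Proof.
by rewrite /borel_measure outer_content_open ?inner_contentT//; exact: openT.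
Qed.

HB.instance Definition _ := Measure_isProbability.Build _ _ _ borel_measure
  borel_measureT.

(** Closed sets only gain mass in passing from L to mu, and open sets only lose
    some: on [0, 1], if L is the limit of point masses at 1 / n, then mu is the
    point mass at 0 and ]0, 1] drops from mass 1 to mass 0. *)
Lemma borel_probability_of_content : exists mu : borel_probability R K,
  forall U, open U -> mu U <= (L U)%:E.
Proof.
exists (borel_measure : probability _ _) => U oU.
apply: le_trans (_ : inner_content U <= _).
  by rewrite -(outer_content_open oU).
apply: ge_ereal_sup => _ [G [cG GU] <-]; rewrite lee_fin; apply: le_L => //.
  exact: closed_measurable.
exact: sub_sigma_algebra.
Qed.

End regular_content.

(** * Weak limits of probabilities along an ultrafilter *)

Lemma ultra_cvg_itv (R : realType) (T : Type) (U : set_system T)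
  (UU : UltraFilter U) (f : T -> R) (a b : R) :
  (forall t, a <= f t <= b) -> exists l : R, f t @[t --> U] --> l.
Proof.
move=> fab; have PU := @ultra_proper _ _ UU.
have [|l [_ fl]] := @segment_compact R a b (f @ U) _.
  by apply: (@filterE _ U) => t; rewrite /= in_itv; exact: fab.
exists l => V nV; have [//|UV] := in_ultra_setVsetC (f @^-1` V) UU.
by have [x []] := fl (~` V) V UV nV.
Qed.

Section weak_limit.
Context (R : realType) (K : ptopologicalType) (T : Type) (U : set_system T).
Context (UU : UltraFilter U) (nu : T -> borel_probability R K).
Hypothesis compactK : compact [set: K].
Hypothesis normalK : normal_space K.
Local Open Scope ereal_scope.

(** The limits of the masses along U form a finitely additive probability, since
    sums pass to limits, but not a countably additive one; mu is its countably
    additive regularization. *)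
Lemma weak_limit_exists : exists mu : borel_probability R K,
  forall O, open O ->
    exists2 l : R, fine (nu t O) @[t --> U] --> l & mu O <= l%:E.
Proof.
have PU := @ultra_proper _ _ UU.
pose L (A : set (borel K)) : R := lim (fine (nu t A) @[t --> U]).
have cvgL (A : set (borel K)) : measurable A ->
    fine (nu t A) @[t --> U] --> L A.
  move=> mA.
  have [t|l nul] := @ultra_cvg_itv R T U UU (fun t => fine (nu t A)) 0 1.
    rewrite fine_ge0//= -lee_fin fineK ?fin_num_measure//.
    exact: probability_le1.
  by rewrite /L (cvg_lim _ nul).
have [A mA||A B mA mB AB|mu muL] :=
    @borel_probability_of_content R K L compactK normalK.
- by apply: limr_ge; [apply/cvg_ex; exists (L A); exact: cvgL|
    apply: nearW => t; rewrite fine_ge0].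
- rewrite /L (_ : (fun t => fine (nu t setT)) = cst 1%R); first exact: lim_cst.
  by apply/funext => t; rewrite probability_setT.
- apply: cvg_lim => //.
  rewrite (_ : (fun t => fine (nu t (A `|` B))) =
    (fun t => fine (nu t A) + fine (nu t B))%R); last first.
    apply/funext => t; rewrite measureU//.
    by rewrite fineD ?fin_num_measure.
  by apply: cvgD; exact: cvgL.
exists mu => O oO; exists (L O); last exact: muL.
by apply: cvgL; exact: sub_sigma_algebra.
Qed.

End weak_limit.

(** The Riemann sum, of mesh e and with m terms, of the layer-cake formula
    writing y as the integral over s > 0 of the indicator of s < y; it turns an
    integral into finitely many masses of superlevel sets. *)
Definition layer_sum (R : realType) (e : R) (m : nat) (y : \bar R) : R :=
  \sum_(k < m) e * ((k.+1%:R * e)%:E < y)%E%:R.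

(** Up to height m * e, the sum is within e of y, from below. *)
Lemma layer_sumP (R : realType) (e : R) (m : nat) (y : \bar R) :
  0 < e -> (0 <= y)%E ->
  [/\ ((m%:R * e)%:E < y)%E -> layer_sum e m y = m%:R * e,
      (y <= (m%:R * e)%:E)%E -> (y <= (layer_sum e m y + e)%:E)%E &
      ((layer_sum e m y)%:E <= y)%E].
Proof.
move=> e0 y0; elim: m => [|m [IH1 IH2 IH3]].
  rewrite /layer_sum big_ord0 mul0r; split => //.
  by move/le_trans; apply; rewrite lee_fin add0r ltW.
have mS : m.+1%:R * e = m%:R * e + e by rewrite -natr1; ring.
have -> : layer_sum e m.+1 y =
    layer_sum e m y + e * ((m.+1%:R * e)%:E < y)%E%:R.
  by rewrite /layer_sum big_ord_recr.
have [my|ym] := ltP (m.+1%:R * e)%:E y.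
  have my' : ((m%:R * e)%:E < y)%E.
    by apply: lt_trans my; rewrite lte_fin mS ltrDl.
  by rewrite mulr1 IH1// -mS; split => //; exact: ltW.
rewrite mulr0 addr0; split => // _.
have [my|] := ltP (m%:R * e)%:E y; last exact: IH2.
by rewrite IH1// -mS.
Qed.

Section weak_limit_lsc.
Context (R : realType) (K : ptopologicalType).
Local Open Scope ereal_scope.

Definition superlevel (f : K -> \bar R) (a : R) : set (borel K) :=
  [set x | a%:E < f x].

Lemma layer_sum_indic (f : K -> \bar R) (e : R) (m : nat) (x : borel K) :
  (layer_sum e m (f x))%:E =
  \sum_(k < m) e%:E * (\1_(superlevel f (k.+1%:R * e)) x)%:E.
Proof.
rewrite /layer_sum -sumEFin; apply: eq_bigr => k _.
by rewrite indicE mem_setE.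
Qed.

Let measurable_superlevel (f : K -> \bar R) (a : R) : lower_semicontinuous f ->
  measurable (superlevel f a).
Proof.
by move=> lf; apply: sub_sigma_algebra; exact: (lower_semicontinuousP f).1.
Qed.

Lemma measurable_layer_sum (f : K -> \bar R) (e : R) (m : nat) :
  lower_semicontinuous f ->
  measurable_fun [set: borel K] (fun x : borel K => (layer_sum e m (f x))%:E).
Proof.
move=> lf; under eq_fun do rewrite layer_sum_indic.
apply: emeasurable_sum => k; apply: measurable_funeM.
apply: measurableT_comp => //; apply: measurable_indic.
exact: measurable_superlevel.
Qed.

Lemma integral_layer_sum (P : borel_probability R K) (f : K -> \bar R) (e : R)
    (m : nat) : (0 < e)%R -> lower_semicontinuous f ->
  \int[P]_x (layer_sum e m (f x))%:E =
  (\sum_(k < m)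
      e * fine (P (superlevel f (k.+1%:R * e))))%:E.
Proof.
move=> e0 lf; pose E (k : nat) := superlevel f (k.+1%:R * e).
have mE k : measurable (E k) by exact: measurable_superlevel.
have mindic k :
    measurable_fun [set: borel K] (fun x => (\1_(E k) x)%:E : \bar R).
  by apply: measurableT_comp => //; apply: measurable_indic; exact: mE.
under eq_integral do rewrite layer_sum_indic.
rewrite ge0_integral_sum//.
- rewrite -sumEFin; apply: eq_bigr => k _.
  rewrite ge0_integralZl_EFin//; [|exact: mindic|exact: ltW].
  rewrite integral_indic//; last exact: mE.
  by rewrite setIT EFinM fineK// fin_num_measure//; exact: mE.
- by move=> k; apply: measurable_funeM; exact: mindic.
- by move=> k x _; rewrite mule_ge0// lee_fin// ltW.
Qed.

(** Each superlevel set of f is open, so its mass under mu is at most the limit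
    of its masses under nu t.  It remains to compare f, through finitely many
    superlevel sets, with a bounded function below f whose integral still
    exceeds a. *)
Lemma weak_limit_integral_lsc (T : Type) (U : set_system T)
  (UU : UltraFilter U) (nu : T -> borel_probability R K)
  (mu : borel_probability R K) (f : K -> \bar R) (a : R) :
  (forall O, open O ->
    exists2 l : R, fine (nu t O) @[t --> U] --> l & mu O <= l%:E) ->
  (forall x, 0 <= f x) -> lower_semicontinuous f ->
  a%:E < \int[mu]_x f x -> \forall t \near U, a%:E < \int[nu t]_x f x.
Proof.
have PU := @ultra_proper _ _ UU.
move=> nu_mu f0 lf; rewrite ge0_integralTE// => /ereal_sup_gt[_ [g gf <-]] ag.
have [N gN] : exists N : R, forall x : borel K, (g x <= N)%R.
  have [M [_ Mg]] := simple_bounded g.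
  exists (`|M| + 1)%R => x; apply: le_trans (ler_norm _) _; apply: Mg => //.
  by rewrite (le_lt_trans (ler_norm M))// ltrDl.
rewrite -integralT_nnsfun in ag.
have [e e0 ae] : exists2 e : R, (0 < e)%R & (a + e)%:E < \int[mu]_x (g x)%:E.
  move: ag; case: (\int[mu]_x (g x)%:E) => [r||]//.
    rewrite lte_fin => ar; exists ((r - a) / 2)%R.
      by rewrite divr_gt0// subr_gt0.
    by rewrite lte_fin; lra.
  by move=> _; exists 1%R => //; rewrite ltry.
pose m := (Num.truncn (N / e)).+1.
have mN : (N <= m%:R * e)%R.
  by rewrite -ler_pdivrMr// ltW// truncnS_gt.
have layer_ge0 y : (0 <= layer_sum e m y)%R.
  by apply: sumr_ge0 => k _; rewrite mulr_ge0// ltW.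
have mlayer := measurable_layer_sum e m lf.
have mf := lower_semicontinuous_borel lf.
have g_layer : \int[mu]_x (g x)%:E <=
    \int[mu]_x ((layer_sum e m (f x))%:E + e%:E).
  apply: ge0_le_integral => //.
  - by move=> x _; rewrite lee_fin.
  - by apply: (measurable_EFinP _ g).2.
  - exact: emeasurable_funD.
  move=> x _; have [S1 S2 _] := layer_sumP m e0 (f0 x).
  have [fm|fm] := ltP (m%:R * e)%:E (f x).
    rewrite S1// -EFinD lee_fin; apply: le_trans (gN x) _.
    by rewrite (le_trans mN)// lerDl ltW.
  exact: le_trans (gf x) (S2 fm).
rewrite ge0_integralD// in g_layer; last 2 first.
- by move=> x _; rewrite lee_fin.
- by move=> x _; rewrite lee_fin ltW.
rewrite integral_cst_probability integral_layer_sum// in g_layer.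
have := lt_le_trans ae g_layer; rewrite -EFinD lte_fin ltrD2r => a_sum.
have oE (k : nat) : open (superlevel f (k.+1%:R * e)).
  exact: (lower_semicontinuousP f).1.
have /choice[l ml] : forall k : nat, exists l : R,
    (fine (nu t (superlevel f (k.+1%:R * e))) @[t --> U] --> l) /\
    mu (superlevel f (k.+1%:R * e)) <= l%:E.
  by move=> k; have [l ? ?] := nu_mu _ (oE k); exists l.
have sum_cvg : (\sum_(k < m) e *
    fine (nu t (superlevel f (k.+1%:R * e))))%R @[t --> U] -->
    (\sum_(k < m) e * l k)%R.
  apply: cvg_big => [|k _]; first exact: add_continuous.
  by apply: cvgM; [exact: cvg_cst|exact: (ml k).1].
have a_lim : (a < \sum_(k < m) e * l k)%R.
  apply: lt_le_trans a_sum _; apply: ler_sum => k _.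
  rewrite ler_pM2l// -lee_fin fineK ?fin_num_measure//; first exact: (ml k).2.
  exact: measurable_superlevel.
have : \forall t \near U, (a < \sum_(k < m) e *
    fine (nu t (superlevel f (k.+1%:R * e))))%R.
  exact: cvgr_gt sum_cvg _ a_lim.
apply: filterS => t at_sum.
apply: (@lt_le_trans _ _ (\int[nu t]_x (layer_sum e m (f x))%:E)).
  by rewrite integral_layer_sum// lte_fin.
apply: ge0_le_integral => //; first by move=> x _; rewrite lee_fin.
by move=> x _; have [] := layer_sumP m e0 (f0 x).
Qed.

End weak_limit_lsc.

(** * Mixtures, shifted integrals and uniqueness of Borel probabilities *)

Section unit_mass_probability.
Context d (T : measurableType d) (R : realType).
Context (mu : {measure set T -> \bar R}).
Hypothesis muT : mu setT = 1%E.

(** The let keeps the proof of unit mass among the parameters, so that the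
    probability structure below can be attached to this name. *)
Definition unit_mass : set T -> \bar R := let _ := muT in mu.

HB.instance Definition _ := Measure.copy unit_mass mu.
HB.instance Definition _ := Measure_isProbability.Build _ _ _ unit_mass muT.

Lemma unit_mass_probability :
  exists P : probability T R, P = mu :> (set T -> \bar R).
Proof. by exists (unit_mass : probability T R). Qed.

End unit_mass_probability.

Lemma probability_mixture (d : measure_display) (T : measurableType d)
  (R : realType) (P Q : probability T R) (s : R) : 0 <= s <= 1 ->
  exists M : probability T R,
    (forall A, measurable A -> M A = s%:E * P A + (1 - s)%:E * Q A)%E /\
    forall f : T -> \bar R, (forall x, 0 <= f x)%E -> measurable_fun setT f ->
    (\int[M]_x f x = s%:E * \int[P]_x f x + (1 - s)%:E * \int[Q]_x f x)%E.
Proof.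
move=> /andP[s0 s1]; have s1' : 0 <= 1 - s by rewrite subr_ge0.
pose M : {measure set T -> \bar R} :=
  measure_add (mscale (NngNum s0) P) (mscale (NngNum s1') Q).
have ME A : M A = (s%:E * P A + (1 - s)%:E * Q A)%E.
  exact: measure_addE.
have MT : M setT = 1%E.
  by rewrite ME !probability_setT !mule1 -EFinD addrC subrK.
have [PM PME] := unit_mass_probability MT.
exists PM; split=> [A _|f f0 mf]; first by rewrite PME ME.
rewrite PME [LHS]ge0_integral_measure_add//.
by rewrite !ge0_integral_mscale.
Qed.

(** When f is not integrable, both sides are -oo: M - f has a bounded positive
    part, and its negative part is at least f - `|M|. *)
Lemma integral_subr (d : measure_display) (T : measurableType d)
  (R : realType) (P : probability T R) (M : R) (f : T -> \bar R) :
  (forall x, 0 <= f x)%E -> measurable_fun setT f ->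
  (\int[P]_x (M%:E - f x) = M%:E - \int[P]_x f x)%E.
Proof.
move=> f0 mf; have iM : P.-integrable setT (cst M%:E).
  exact: finite_measure_integrable_cst.
have [fi|fNi] := boolP (\int[P]_x f x < +oo)%E.
  have If : P.-integrable setT f.
    apply/integrableP; split => //.
    by under eq_integral do rewrite gee0_abs//.
  by rewrite integralB// integral_cst_probability.
have fy : (\int[P]_x f x = +oo)%E.
  by apply/eqP; rewrite -leye_eq leNgt.
rewrite fy addeNy.
set g := fun x => (M%:E - f x)%E.
have mg : measurable_fun setT g by apply: emeasurable_funB.
have gpos : (\int[P]_x g^\+ x < +oo)%E.
  apply: (@le_lt_trans _ _ (\int[P]_x `|M|%:E)%E).
    apply: ge0_le_integral => //.
    + exact: measurable_funepos.
    + move=> x _; rewrite funeposE/g ge_max lee_fin normr_ge0 andbT.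
      case: (f x) (f0 x) => [r||]//=; rewrite ?lee_fin => r0; last exact: leNye.
      by have := ler_norm M; lra.
  by rewrite integral_cst_probability ltry.
have gneg : (\int[P]_x g^\- x = +oo)%E.
  apply/eqP; rewrite -leye_eq leNgt; apply/negP => gnegy.
  move: fNi; apply/negP; rewrite negbK.
  apply: (@le_lt_trans _ _ (\int[P]_x (g^\- x + `|M|%:E))%E).
    apply: ge0_le_integral => //.
    + by apply: emeasurable_funD => //; exact: measurable_funeneg.
    + move=> x _; rewrite funenegE /g.
      apply: (@le_trans _ _ (- (M%:E - f x) + `|M|%:E)%E); last first.
        by rewrite leeD2r// le_max lexx.
      case: (f x) (f0 x) => [r||]//= r0.
      by rewrite lee_fin; have := ler_norm M; lra.
  rewrite ge0_integralD//; last exact: measurable_funeneg.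
  by rewrite lte_add_pinfty// integral_cst_probability ltry.
rewrite integralE gneg.
by rewrite -(@fineK _ (\int[P]_x g^\+ x)) ?ge0_fin_numE ?integral_ge0//.
Qed.

(** F n plays the part of the points at distance at least 1 / (n + 1) from the
    complement of U; balls are replaced by their interiors, because in a
    pseudometric structure they need not be open. *)
Lemma open_Fsigma_nondecreasing (R : realType) (X : pseudoPMetricType R)
  (U : set X) : open U -> exists F : (set X)^nat,
  [/\ forall n, closed (F n), nondecreasing_seq F & \bigcup_n F n = U].
Proof.
move=> oU.
pose F n := ~` (\bigcup_(y in ~` U) interior (ball y (n.+1%:R^-1 : R))).
have Fball n x y : F n x -> ~ U y -> ~ interior (ball y (n.+1%:R^-1 : R)) x.
  by move=> Fx Uy yx; apply: Fx; exists y.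
exists F; split.
- move=> n; apply: open_closedC; apply: bigcup_open => y _.
  exact: open_interior.
- move=> m n mn; apply/subsetPset; apply: subsetC => x [y Uy yx].
  exists y => //.
  apply: interiorS yx => z; apply: le_ball.
  by rewrite lef_pV2 ?posrE// ler_nat ltnS.
- apply/seteqP; split=> [x [n _] Fx|x Ux].
    apply: contrapT => /(Fball n x _ Fx); apply; apply: nbhsx_ballx.
    by rewrite invr_gt0.
  have /nbhs_ballP[e /= e0 eU] : nbhs x U by exact: open_nbhs_nbhs.
  have [n ne] : exists n : nat, n.+1%:R^-1 < e.
    have [N _ /(_ N (leqnn _))] := near_infty_natSinv_lt (PosNum e0).
    by exists N.
  exists n => // -[y Uy /interior_subset yx]; apply: Uy; apply: eU.
  by apply: ball_sym; apply: le_ball yx; exact: ltW.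
Qed.

(** Both measures have total mass 1, so complements give the reverse inequality
    on closed sets, and exhausting open sets by closed ones gives it on open
    sets.  Thus P and Q agree on open sets, which generate the Borel sets. *)
Lemma borel_probability_eq_of_le_open (R : realType) (X : pseudoPMetricType R)
  (P Q : borel_probability R X) :
  (forall U, open U -> P U <= Q U)%E ->
  forall A : set (borel X), measurable A -> P A = Q A.
Proof.
move=> PQ A mA; have mo (U : set (borel X)) : open U -> measurable U.
  by move=> oU; exact: sub_sigma_algebra.
have PQF (F : set (borel X)) : closed F -> (Q F <= P F)%E.
  move=> cF; have oF := closed_openC cF.
  have mF : measurable F by rewrite -[F]setCK; apply: measurableC; exact: mo.
  by have := PQ _ oF; rewrite !probability_setC// leeD2lE// leeN2.
apply: (@measure_unique _ R (borel X) (@open X) (fun=> setT) _ _ _ _ P Q) => //.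
- by move=> U V; exact: openI.
- by move=> _; exact: openT.
- by rewrite bigcup_const//; exists 0%N.
- move=> U oU; apply/eqP; rewrite eq_le PQ//=.
  have [F [cF ndF FU]] := open_Fsigma_nondecreasing oU.
  have mF n : measurable (F n : set (borel X)).
    by rewrite -[F n]setCK; apply: measurableC; apply: mo; exact: closed_openC.
  have mU := mo _ oU.
  have cvF : Q (F n) @[n --> \oo] --> Q U.
    rewrite -FU; apply: nondecreasing_cvg_mu => //.
    by rewrite FU.
  rewrite -(cvg_lim _ cvF)//; apply: lime_le.
    by apply/cvg_ex; exists (Q U).
  apply: nearW => n; apply: le_trans (PQF _ (cF n)) _.
  by apply: le_measure; rewrite ?inE// -FU; exact: bigcup_sup.
- by move=> _; rewrite (le_lt_trans (probability_le1 _ _))// ltry.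
Qed.

(** * Couplings *)

(** Weak limits of couplings are taken on X * X, where the results above need the
    base point and the product topology as one structure. *)
HB.instance Definition _ (S T : ptopologicalType) := Pointed.on (S * T)%type.



(** On the cylinder over an open set the masses along U are constant, equal to
    the mass under mu; so the first marginal of gamma is at most mu on open
    sets, and [borel_probability_eq_of_le_open] upgrades this to equality. *)
Lemma first_marginal_weak_limit (R : realType) (X : pmetricType R) (T : Type)
  (U : set_system T) (UU : UltraFilter U)
  (nu : T -> borel_probability R (X * X)) (gamma : borel_probability R (X * X))
  (mu : borel_probability R X) :
  (forall O : set (X * X), open O ->
    exists2 l : R, fine (nu t O) @[t --> U] --> l & (gamma O <= l%:E)%E) ->
  (\forall t \near U, first_marginal (nu t) mu) ->
  first_marginal gamma mu.
Proof.
move=> nu_gamma nu_mu A mA.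
have PU := @ultra_proper _ _ UU.
have cfst : continuous (fst : X * X -> X) by move=> ?; exact: cvg_fst.
have mfst : measurable_fun [set: borel (X * X)]
    (fst : borel (X * X) -> borel X).
  exact: (@continuous_borel_measurable (X * X)%type X).
pose P : borel_probability R X := distribution gamma
  (mfun_Sub (mem_set mfst) : {mfun borel (X * X) >-> borel X}).
rewrite -[LHS]/(P A).
apply: borel_probability_eq_of_le_open mA => O oO.
have oO' : open (fst @^-1` O : set (X * X)).
  by apply: open_comp => // x _; exact: cfst.
have [l nul gl] := nu_gamma _ oO'.
apply: le_trans gl _.
have -> : l = fine (mu O).
  apply: (cvg_unique _ nul) => //.
  apply: cvg_near_cst; move: nu_mu; apply: filterS => t tmu.
  by rewrite -tmu//; exact: sub_sigma_algebra.
by rewrite fineK// fin_num_measure//; exact: sub_sigma_algebra.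
Qed.

Lemma diagonal_coupling (R : realType) (X : pmetricType R)
  (mu : borel_probability R X) :
  exists gamma : borel_probability R (X * X), first_marginal gamma mu.
Proof.
pose diag : borel X -> borel (X * X) := fun x => (x, x).
have mdiag : measurable_fun setT diag.
  apply: (@continuous_borel_measurable X (X * X)%type) => x.
  by apply: cvg_pair; exact: cvg_id.
pose gamma : borel_probability R (X * X) := distribution mu
  (mfun_Sub (mem_set mdiag) : {mfun borel X >-> borel (X * X)}).
by exists gamma => A mA.
Qed.

(** * Convex functions on the real line *)

Section convex_real_function.
Context (R : realType) (l : R -> R).
Hypothesis l_ge0 : forall t, 0 <= l t.
Hypothesis l_convex : convex_function [set: R^o] l.

Lemma convex_functionP (x y t : R) : 0 <= t <= 1 ->
  l (t * x + (1 - t) * y) <= t * l x + (1 - t) * l y.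
Proof.
move=> /andP[t0 t1].
have := @l_convex (Itv01 t0 t1) x y (mem_setT _) (mem_setT _).
by rewrite !convRE.
Qed.

(** Near x, l lies below its chords from x to x + 1 and from x - 1 to x, and
    these chords tend to l x at x.  As l >= 0, the sum of the two end values
    bounds both; r is small enough for the chords to stay below a. *)
Lemma convex_upper_semicontinuous (x a : R) : l x < a ->
  \forall y \near x, l y < a.
Proof.
move=> la; pose C := l (x + 1) + l (x - 1).
have C0 : 0 <= C by rewrite addr_ge0.
pose r := (a - l x) / (a + C).
have a0 : 0 < a by apply: le_lt_trans la.
have aC0 : 0 < a + C by rewrite ltr_wpDr.
have r0 : 0 < r by rewrite divr_gt0// subr_gt0.
have r1 : r <= 1 by rewrite ler_pdivrMr// mul1r; have := l_ge0 x; lra.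
have rE : r * (a + C) = a - l x by rewrite /r mulfVK// gt_eqF.
have secant (s z : R) : 0 <= s -> s < r -> l z <= C ->
    l ((1 - s) * x + s * z) < a.
  move=> s0 sr zC; have s1 : 0 <= 1 - s <= 1 by lra.
  have := convex_functionP x z s1; rewrite (_ : 1 - (1 - s) = s); last ring.
  move=> /le_lt_trans; apply.
  have : s * (a + C) < r * (a + C) by rewrite ltr_pM2r.
  have := l_ge0 x; have := l_ge0 z; nra.
exists r => // y /=; rewrite /ball/= => yx.
have [xy|yx'] := leP x y.
  rewrite (_ : y = (1 - (y - x)) * x + (y - x) * (x + 1)); last ring.
  apply: secant; first by rewrite subr_ge0.
    by rewrite distrC ger0_norm ?subr_ge0// in yx.
  by rewrite lerDl.
rewrite (_ : y = (1 - (x - y)) * x + (x - y) * (x - 1)); last ring.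
apply: secant; first by rewrite subr_ge0 ltW.
  by rewrite ger0_norm ?subr_ge0 ?ltW// in yx.
by rewrite lerDr.
Qed.

Lemma convex_bounded (B t : R) : 0 < B -> `|t| <= B -> l t <= l B + l (- B).
Proof.
move=> B0; rewrite ler_norml => /andP[tB1 tB2].
pose s := (t + B) / (2 * B).
have s01 : 0 <= s <= 1.
  by apply/andP; split; [rewrite divr_ge0|rewrite ler_pdivrMr]; lra.
have tE : t = s * B + (1 - s) * - B.
  have sE : s * (2 * B) = t + B by rewrite /s mulfVK// gt_eqF// mulr_gt0.
  by lra.
rewrite {1}tE; apply: le_trans (convex_functionP _ _ s01) _.
by have := l_ge0 B; have := l_ge0 (- B); nra.
Qed.

End convex_real_function.

(** * One-sided payoffs *)

Section one_sided_payoff.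
Context (R : realType) (X : pmetricType R) (l : R -> R) (c : X * X -> \bar R).
Hypothesis compactX : compact [set: X].
Hypothesis l_ge0 : forall t, 0 <= l t.
Hypothesis l_convex : convex_function [set: R^o] l.
Hypothesis c_ge0 : forall p, (0 <= c p)%E.
Hypothesis c_lsc : lower_semicontinuous c.
Local Open Scope ereal_scope.

Let K : ptopologicalType := (X * X)%type.

Definition payoff (h : X -> R) (gamma : borel_probability R (X * X)) : \bar R :=
  \int[gamma]_p ((l (h p.2))%:E - c p).

(** What separates the integrand of the payoff from its bound M: nonnegative and
    lower semicontinuous, so that the results on nonnegative integrals and on
    weak limits apply to the payoff without any integrability condition. *)
Definition deficit (M : R) (h : X -> R) (p : X * X) : \bar R :=
  (M - l (h p.2))%:E + c p.

Lemma loss_bounded (h : X -> R) : continuous h ->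
  exists M : R, forall x, (l (h x) <= M)%R.
Proof.
move=> ch.
have /compact_bounded[B [_ hB]] : compact (h @` setT).
  by apply: continuous_compact => //; exact: continuous_subspaceT.
exists (l (`|B| + 1) + l (- (`|B| + 1)))%R => x.
have B0 : (0 < `|B| + 1)%R by rewrite ltr_wpDl.
apply: (convex_bounded l_ge0 l_convex B0); apply: hB; last by exists x.
by rewrite (le_lt_trans (ler_norm B))// ltrDl.
Qed.

Section fixed_bound.
Variables (M : R) (h : X -> R).
Hypotheses (ch : continuous h) (hM : forall x, (l (h x) <= M)%R).

Lemma deficit_ge0 p : 0 <= deficit M h p.
Proof. by rewrite adde_ge0// lee_fin subr_ge0. Qed.

(** c is lower semicontinuous, and l is upper semicontinuous by convexity. *)
Lemma deficit_lsc : lower_semicontinuous (deficit M h).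
Proof.
move=> p a ap.
have [b bc ab] : exists2 b : R, b%:E < c p & (a < M - l (h p.2) + b)%R.
  move: ap; rewrite /deficit; case: (c p) (c_ge0 p) => [r||]// _.
    rewrite -EFinD lte_fin => ar; exists ((r + (a - (M - l (h p.2)))) / 2)%R.
      by rewrite lte_fin; lra.
    by lra.
  by move=> _; exists (a - (M - l (h p.2)) + 1)%R; [rewrite ltry|lra].
have [V pV cV] := c_lsc bc.
have lh : (l (h p.2) < M + b - a)%R by lra.
have nh : \forall q \near p, (l (h q.2) < M + b - a)%R.
  have ch2 : h q.2 @[q --> p] --> h p.2.
    by apply: (continuous_comp (f := snd) (g := h)); [exact: cvg_snd|exact: ch].
  exact: (ch2 _ (convex_upper_semicontinuous l_ge0 l_convex lh)).
exists (V `&` [set q | (l (h q.2) < M + b - a)%R]); first exact: filterI.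
move=> q [/cV bq /= lq]; rewrite /deficit.
apply: (@lt_trans _ _ ((M - l (h q.2))%:E + b%:E)).
  by rewrite -EFinD lte_fin; lra.
by rewrite lteD2lE.
Qed.

Lemma measurable_deficit : measurable_fun [set: borel (X * X)]
  (deficit M h : borel (X * X) -> \bar R).
Proof. exact: (@lower_semicontinuous_borel R K _ deficit_lsc). Qed.

Lemma payoff_deficit (gamma : borel_probability R (X * X)) :
  payoff h gamma = M%:E - \int[gamma]_p deficit M h p.
Proof.
rewrite -integral_subr//; last 2 first.
- exact: deficit_ge0.
- exact: measurable_deficit.
apply: eq_integral => p _; rewrite /deficit.
case: (c p) (c_ge0 p) => [r||]//= _; congr (_%:E); ring.
Qed.

Let measurable_cost : measurable_fun [set: borel (X * X)]
  (c : borel (X * X) -> \bar R).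
Proof. exact: (@lower_semicontinuous_borel R K). Qed.

(** The deficit and the cost differ by a bounded function, so whether a payoff
    is finite depends on the coupling alone, not on h. *)
Lemma integral_deficit_lty (gamma : borel_probability R (X * X)) :
  (\int[gamma]_p deficit M h p < +oo) = (\int[gamma]_p c p < +oo).
Proof.
apply/idP/idP.
  apply: le_lt_trans; apply: ge0_le_integral => //.
  - exact: measurable_deficit.
  - by move=> p _; rewrite leeDr// lee_fin subr_ge0.
move=> cy; have M0 : (0 <= M)%R by apply: le_trans (hM point).
apply: (@le_lt_trans _ _ (\int[gamma]_p (M%:E + c p))).
  apply: ge0_le_integral => //.
  - by move=> p _; exact: deficit_ge0.
  - exact: measurable_deficit.
  - by apply: emeasurable_funD.
  - by move=> p _; rewrite leeD2r// lee_fin gerBl.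
by rewrite ge0_integralD// integral_cst_probability lte_add_pinfty// ltry.
Qed.

Lemma payoff_lty (gamma : borel_probability R (X * X)) : payoff h gamma < +oo.
Proof.
rewrite payoff_deficit; apply: (@le_lt_trans _ _ M%:E); last exact: ltry.
rewrite -[leRHS]sube0; apply: leeB => //; apply: integral_ge0 => p _.
exact: deficit_ge0.
Qed.

Lemma payoff_fin_num (gamma : borel_probability R (X * X)) :
  \int[gamma]_p c p < +oo -> payoff h gamma \is a fin_num.
Proof.
rewrite -integral_deficit_lty payoff_deficit => dy.
rewrite fin_numB/= ge0_fin_numE ?dy// integral_ge0// => p _.
exact: deficit_ge0.
Qed.

Lemma payoff_Ny (gamma : borel_probability R (X * X)) :
  ~~ (\int[gamma]_p c p < +oo) -> payoff h gamma = -oo.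
Proof.
rewrite -integral_deficit_lty -leNgt leye_eq payoff_deficit => /eqP ->.
by rewrite addeNy.
Qed.

Lemma payoff_mixture (P Q gamma : borel_probability R (X * X)) (s : R) :
  (0 <= s <= 1)%R ->
  (forall f : X * X -> \bar R, (forall p, 0 <= f p) ->
     measurable_fun [set: borel (X * X)] (f : borel (X * X) -> \bar R) ->
     \int[gamma]_p f p = s%:E * \int[P]_p f p + (1 - s)%:E * \int[Q]_p f p) ->
  \int[P]_p c p < +oo -> \int[Q]_p c p < +oo ->
  payoff h gamma = s%:E * payoff h P + (1 - s)%:E * payoff h Q.
Proof.
rewrite -!integral_deficit_lty => s01 mix Py Qy.
rewrite !payoff_deficit mix; [|exact: deficit_ge0|exact: measurable_deficit].
have d0 (P' : borel_probability R (X * X)) : 0 <= \int[P']_p deficit M h p.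
  by apply: integral_ge0 => p _; exact: deficit_ge0.
have := d0 P; have := d0 Q; move: Py Qy.
case: (\int[P]_p deficit M h p) => [x||]//;
  case: (\int[Q]_p deficit M h p) => [y||]//.
by move=> _ _ _ _; rewrite -!(EFinM, EFinB, EFinD, EFinN); congr (_%:E); ring.
Qed.

Lemma payoff_weak_limit (T : Type) (U : set_system T) (UU : UltraFilter U)
  (nu : T -> borel_probability R (X * X)) (gamma : borel_probability R (X * X))
  (a : R) :
  (forall O : set (X * X), open O ->
    exists2 r : R, fine (nu t O) @[t --> U] --> r & gamma O <= r%:E) ->
  payoff h gamma < a%:E -> \forall t \near U, payoff h (nu t) < a%:E.
Proof.
have PU := @ultra_proper _ _ UU.
move=> nu_gamma; rewrite payoff_deficit => Ma.
have /(@weak_limit_integral_lsc R K T U UU nu gamma _ (M - a) nu_gamma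
    deficit_ge0 deficit_lsc) : (M - a)%:E < \int[gamma]_p deficit M h p.
  move: Ma; case: (\int[gamma]_p deficit M h p) => [r||]//.
    by rewrite -EFinB !lte_fin; lra.
  by rewrite ltry.
apply: filterS => t; rewrite payoff_deficit.
case: (\int[nu t]_p deficit M h p) => [r||]//.
  by rewrite -EFinB !lte_fin; lra.
by move=> _; rewrite addeNy ltNyr.
Qed.

End fixed_bound.

Lemma payoff_convex (h k : X -> R) (t : R)
    (gamma : borel_probability R (X * X)) :
  continuous h -> continuous k -> (0 <= t <= 1)%R ->
  continuous (fun x => t * h x + (1 - t) * k x)%R ->
  \int[gamma]_p c p < +oo ->
  payoff (fun x => t * h x + (1 - t) * k x)%R gamma <=
  t%:E * payoff h gamma + (1 - t)%:E * payoff k gamma.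
Proof.
move=> ch ck t01 chk cy.
have [M1 hM1] := loss_bounded ch; have [M2 hM2] := loss_bounded ck.
have [M3 hM3] := loss_bounded chk.
pose M := Num.max M1 (Num.max M2 M3).
have hM x : (l (h x) <= M)%R by rewrite !le_max hM1.
have kM x : (l (k x) <= M)%R by rewrite !le_max hM2 orbT.
have hkM x : (l (t * h x + (1 - t) * k x) <= M)%R by rewrite !le_max hM3 !orbT.
set hk := (fun x => _) in chk *.
have le_deficit : t%:E * \int[gamma]_p deficit M h p +
    (1 - t)%:E * \int[gamma]_p deficit M k p <= \int[gamma]_p deficit M hk p.
  have [t0 t1] := andP t01.
  have dh := deficit_ge0 hM; have dk := deficit_ge0 kM.
  have mh := measurable_deficit M ch; have mk := measurable_deficit M ck.
  rewrite -!ge0_integralZl_EFin ?subr_ge0// -ge0_integralD//; last 4 first.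
  - by move=> p _; rewrite mule_ge0.
  - exact: measurable_funeM.
  - by move=> p _; rewrite mule_ge0// lee_fin subr_ge0.
  - exact: measurable_funeM.
  apply: ge0_le_integral => //.
  - move=> p _; rewrite adde_ge0// mule_ge0// lee_fin ?subr_ge0//.
  - by apply: emeasurable_funD; exact: measurable_funeM.
  - exact: measurable_deficit.
  move=> p _; rewrite /deficit /hk.
  have := convex_functionP l_convex (h p.2) (k p.2) t01.
  case: (c p) (c_ge0 p) => [r||]// _.
    by rewrite -!(EFinM, EFinD) lee_fin; nra.
  by move=> _; rewrite [leRHS]addey// leey.
have := payoff_fin_num ch hM cy; have := payoff_fin_num ck kM cy.
have := payoff_fin_num chk hkM cy.
move: le_deficit; rewrite !(payoff_deficit _ hM)// !(payoff_deficit _ kM)//.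
rewrite (payoff_deficit _ hkM)//.
case: (\int[gamma]_p deficit M h p) => [x||]//;
  case: (\int[gamma]_p deficit M k p) => [y||]//;
  case: (\int[gamma]_p deficit M hk p) => [z||]//.
rewrite -!(EFinM, EFinB, EFinD) !lee_fin => ? _ _ _; lra.
Qed.

End one_sided_payoff.

(** * The minimax equality *)

Lemma lte_split (R : realType) (x y : \bar R) (v : R) :
  (x < +oo -> y < +oo -> x + y < v%:E ->
  exists a b : R, [/\ x < a%:E, y < b%:E & (a + b <= v)%R])%E.
Proof.
case: x => [x||]//; case: y => [y||]// _ _.
- rewrite -EFinD lte_fin => xyv; pose e := (v - (x + y)) / 2.
  by exists (x + e), (y + e); split; rewrite ?lte_fin /e; lra.
- move=> _; exists (x + 1), (v - (x + 1)).
  split; rewrite ?ltNyr ?lte_fin//; lra.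
- move=> _; exists (v - (y + 1)), (y + 1).
  split; rewrite ?ltNyr ?lte_fin//; lra.
- by move=> _; exists v, 0; split; rewrite ?ltNyr// addr0.
Qed.

Section minimax_equality.
Context (R : realType) (X : pmetricType R) (mu1 mum1 : borel_probability R X)
  (l1 lm1 : R -> R) (c1 cm1 : X * X -> \bar R).
Hypothesis compactX : compact [set: X].
Hypotheses (l1_ge0 : forall t, 0 <= l1 t) (lm1_ge0 : forall t, 0 <= lm1 t).
Hypotheses (l1_convex : convex_function [set: R^o] l1)
  (lm1_convex : convex_function [set: R^o] lm1).
Hypotheses (c1_ge0 : forall p, (0 <= c1 p)%E)
  (cm1_ge0 : forall p, (0 <= cm1 p)%E).
Hypotheses (c1_lsc : lower_semicontinuous c1)
  (cm1_lsc : lower_semicontinuous cm1).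
Local Open Scope ereal_scope.

Let D := Delta mu1 mum1.
Let V := ereal_inf [set ereal_sup [set J l1 lm1 c1 cm1 h gamma | gamma in D]
                   | h in Cfun X].

(** The family of sets A(h, v) is indexed by pairs (h, v), so that thresholds are
   averaged together with test functions. *)
Let test := ((X -> R) * R)%type.
Let admissible : set test := [set i | continuous i.1 /\ i.2%:E < V].
Let finite_cost :=
  [set g : borel_probability R (X * X) * borel_probability R (X * X) |
  [/\ D g, \int[g.1]_p c1 p < +oo & \int[g.2]_p cm1 p < +oo]].

Let JE h g : J l1 lm1 c1 cm1 h g = payoff l1 c1 h g.1 + payoff lm1 cm1 h g.2.
Proof. by []. Qed.

(** The alternative of the first part concerns real-valued functions, hence this
    domain; the couplings left out have J = -oo for every h at once ([J_Ny]) and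
    so never exceed a threshold. *)
Lemma J_fin_num h g : continuous h -> finite_cost g ->
  J l1 lm1 c1 cm1 h g \is a fin_num.
Proof.
move=> ch [_ g1 g2].
have [M hM] := loss_bounded compactX l1_ge0 l1_convex ch.
have [N hN] := loss_bounded compactX lm1_ge0 lm1_convex ch.
rewrite JE fin_numD (payoff_fin_num l1_ge0 l1_convex c1_ge0 c1_lsc ch hM)//.
by rewrite (payoff_fin_num lm1_ge0 lm1_convex cm1_ge0 cm1_lsc ch hN).
Qed.

Lemma J_Ny h g : continuous h -> D g -> ~ finite_cost g ->
  J l1 lm1 c1 cm1 h g = -oo.
Proof.
move=> ch Dg nfg.
have [M hM] := loss_bounded compactX l1_ge0 l1_convex ch.
have [N hN] := loss_bounded compactX lm1_ge0 lm1_convex ch.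
rewrite JE; have [g1|g1] := boolP (\int[g.1]_p c1 p < +oo); last first.
  by rewrite (payoff_Ny l1_ge0 l1_convex c1_ge0 c1_lsc ch hM).
have [g2|g2] := boolP (\int[g.2]_p cm1 p < +oo); first by case: nfg.
by rewrite (payoff_Ny lm1_ge0 lm1_convex cm1_ge0 cm1_lsc ch hN)// addeNy.
Qed.

Lemma J_mixture p q s : finite_cost p -> finite_cost q -> (0 <= s <= 1)%R ->
  exists2 r, finite_cost r & forall h, continuous h ->
  (s * fine (J l1 lm1 c1 cm1 h p) + (1 - s) * fine (J l1 lm1 c1 cm1 h q) =
   fine (J l1 lm1 c1 cm1 h r))%R.
Proof.
move=> fp fq s01; have := fp; have := fq.
move=> [[q11 q12] q1 q2] [[p11 p12] p1 p2].
have [r1 [r1E r1I]] := probability_mixture p.1 q.1 s01.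
have [r2 [r2E r2I]] := probability_mixture p.2 q.2 s01.
have s0 : (0 <= 1 - s)%R by lra.
have finite_mix (a b : \bar R) : 0 <= a -> 0 <= b -> a < +oo -> b < +oo ->
    s%:E * a + (1 - s)%:E * b < +oo.
  by case: a => [a||]//; case: b => [b||]// *; rewrite -!EFinM -EFinD ltry.
have marginal (a b r : borel_probability R (X * X)) mu :
    first_marginal a mu -> first_marginal b mu ->
    (forall A, measurable A -> r A = s%:E * a A + (1 - s)%:E * b A) ->
    first_marginal r mu.
  move=> am bm rE A mA.
  have mA' : measurable (fst @^-1` A : set (borel (X * X))).
    rewrite -[X in measurable X]setTI.
    have cfst : continuous (fst : X * X -> X) by move=> ?; exact: cvg_fst.
    exact: (@continuous_borel_measurable (X * X)%type X _ cfst).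
  rewrite /pushforward rE//.
  rewrite -[a _]/(pushforward a (fst : borel (X * X) -> borel X) A) am//.
  rewrite -[b _]/(pushforward b (fst : borel (X * X) -> borel X) A) bm//.
  rewrite -(@fineK _ (mu A)) ?fin_num_measure// -!EFinM -EFinD.
  by congr (_%:E); ring.
exists (r1, r2).
  split => /=; first by split; [exact: marginal r1E|exact: marginal r2E].
  - rewrite r1I//; last exact: (@lower_semicontinuous_borel R (X * X)%type).
    by apply: finite_mix => //; apply: integral_ge0.
  - rewrite r2I//; last exact: (@lower_semicontinuous_borel R (X * X)%type).
    by apply: finite_mix => //; apply: integral_ge0.
move=> h ch.
have [M hM] := loss_bounded compactX l1_ge0 l1_convex ch.
have [N hN] := loss_bounded compactX lm1_ge0 lm1_convex ch.
have fin1 := payoff_fin_num l1_ge0 l1_convex c1_ge0 c1_lsc ch hM.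
have fin2 := payoff_fin_num lm1_ge0 lm1_convex cm1_ge0 cm1_lsc ch hN.
rewrite !JE/= (payoff_mixture l1_ge0 l1_convex c1_ge0 c1_lsc ch hM s01 r1I)//.
rewrite (payoff_mixture lm1_ge0 lm1_convex cm1_ge0 cm1_lsc ch hN s01 r2I)//.
rewrite -(fineK (fin1 _ p1)) -(fineK (fin1 _ q1)).
rewrite -(fineK (fin2 _ p2)) -(fineK (fin2 _ q2)).
by rewrite /=; ring.
Qed.

Lemma J_convex h k t : continuous h -> continuous k -> (0 <= t <= 1)%R ->
  exists2 m, continuous m & forall p, finite_cost p ->
  (fine (J l1 lm1 c1 cm1 m p) <=
   t * fine (J l1 lm1 c1 cm1 h p) + (1 - t) * fine (J l1 lm1 c1 cm1 k p))%R.
Proof.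
move=> ch ck t01; pose m x := (t * h x + (1 - t) * k x)%R.
have cm : continuous m.
  move=> x; apply: cvgD; (apply: cvgM; first exact: cvg_cst).
    exact: ch.
  exact: ck.
exists m => // p fp; have [_ p1 p2] := fp.
rewrite -lee_fin fineK; last exact: J_fin_num.
rewrite EFinD !EFinM !fineK; [|exact: J_fin_num..].
rewrite !JE.
have ineq1 :=
  payoff_convex compactX l1_ge0 l1_convex c1_ge0 c1_lsc ch ck t01 cm p1.
have ineq2 :=
  payoff_convex compactX lm1_ge0 lm1_convex cm1_ge0 cm1_lsc ch ck t01 cm p2.
apply: le_trans (leeD ineq1 ineq2) _.
have [M hM] := loss_bounded compactX l1_ge0 l1_convex ch.
have [N hN] := loss_bounded compactX lm1_ge0 lm1_convex ch.
have [M' kM] := loss_bounded compactX l1_ge0 l1_convex ck.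
have [N' kN] := loss_bounded compactX lm1_ge0 lm1_convex ck.
rewrite -(fineK (payoff_fin_num l1_ge0 l1_convex c1_ge0 c1_lsc ch hM p1)).
rewrite -(fineK (payoff_fin_num lm1_ge0 lm1_convex cm1_ge0 cm1_lsc ch hN p2)).
rewrite -(fineK (payoff_fin_num l1_ge0 l1_convex c1_ge0 c1_lsc ck kM p1)).
rewrite -(fineK (payoff_fin_num lm1_ge0 lm1_convex cm1_ge0 cm1_lsc ck kN p2)).
by rewrite -!(EFinM, EFinD) lee_fin; lra.
Qed.

Let above (i : test) := [set g | D g /\ i.2%:E < J l1 lm1 c1 cm1 i.1 g].

(** Otherwise the alternative yields an admissible (h, v) with J h <= v
    throughout Delta, so that V <= v, whereas v < V. *)
Lemma above_finI (i0 : test) : admissible i0 -> finI admissible above.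
Proof.
move=> Ai0 s sA; apply: contrapT => s0.
pose F (i : test) g := (fine (J l1 lm1 c1 cm1 i.1 g) - i.2)%R.
have [|||||[h v] [/= ch vV] Fhv] := @convex_concave_alternative R test _ F
    admissible i0 (finmap.enum_fset s) finite_cost.
- exact: Ai0.
- by move=> i /sA; rewrite inE.
- move=> i j t [ci iV] [cj jV] t01; have [m cm mE] := J_convex ci cj t01.
  exists (m, t * i.2 + (1 - t) * j.2)%R; last first.
    by move=> p fp; rewrite /F/=; have := mE _ fp; lra.
  split => //=; apply: (@le_lt_trans _ _ (Num.max i.2 j.2)%:E).
    rewrite lee_fin; have [ij|ij] := leP i.2 j.2; nra.
  by case: (leP i.2 j.2).
- move=> p q t fp fq t01; have [r fr rE] := J_mixture fp fq t01.
  exists r => // i [ci _]; rewrite /F -rE//; lra.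
- move=> g fg; apply: contrapT => no_i; apply: s0; exists g => i /= si.
  have [Dg _ _] := fg; split => //.
  have [ci _] : admissible i by have := sA _ si; rewrite inE.
  rewrite -(fineK (J_fin_num ci fg)) lte_fin ltNge; apply/negP => ile.
  by apply: no_i; exists i => //; rewrite /F subr_le0.
suff : V <= v%:E by rewrite leNgt vV.
apply: (@le_trans _ _ (ereal_sup [set J l1 lm1 c1 cm1 h gamma | gamma in D])).
  by apply: ereal_inf_lbound; exists h.
apply: ge_ereal_sup => _ [g Dg <-].
have [fg|nfg] := pselect (finite_cost g); last by rewrite J_Ny// leNye.
rewrite -(fineK (J_fin_num ch fg)) lee_fin.
by have := Fhv _ fg; rewrite /F subr_le0.
Qed.

(** The witness is the weak limit of the couplings along an ultrafilter that
    contains all the sets A(h, v). *)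
Lemma maximin_coupling_exists : exists2 g, D g &
  forall h, continuous h -> V <= J l1 lm1 c1 cm1 h g.
Proof.
(* If V = -oo there is no threshold below V and any element of Delta will do. *)
have [VNy|VNy] := eqVneq V -oo.
  have [g1 mg1] := diagonal_coupling mu1.
  have [g2 mg2] := diagonal_coupling mum1.
  by exists (g1, g2) => // h ch; rewrite VNy leNye.
have [v0 v0V] : exists v0 : R, v0%:E < V.
  move: VNy; case: V => [v||]// _; last by exists 0%R; rewrite ltry.
  by exists (v - 1)%R; rewrite lte_fin; lra.
have c0 : continuous (fun _ : X => 0%R : R) by move=> x; exact: cvg_cst.
have A0 : admissible ((fun=> 0%R), v0) by [].
have FF := finI_filter (above_finI A0).
have [U [UU FU]] := ultraFilterLemma FF.
have PU := @ultra_proper _ _ UU.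
have Uabove i : admissible i -> U (above i).
  by move=> Ai; apply: FU; exists (above i) => //; exact: finI_from1.
have UD : U D by apply: filterS (Uabove _ A0) => g [].
have compactXX : compact [set: X * X] by rewrite -setXTT; exact: compact_setX.
have normalXX : normal_space (X * X)%type by exact: (@pseudometric_normal R).
have [g1 nu1] := @weak_limit_exists R (X * X)%type _ U UU
  (fun g => g.1) compactXX normalXX.
have [g2 nu2] := @weak_limit_exists R (X * X)%type _ U UU
  (fun g => g.2) compactXX normalXX.
have Dg : D (g1, g2).
  split => /=.
    by apply: (first_marginal_weak_limit UU nu1); apply: filterS UD => g [].
  by apply: (first_marginal_weak_limit UU nu2); apply: filterS UD => g [].
exists (g1, g2) => // h ch; rewrite leNgt; apply/negP => JV.
have [M hM] := loss_bounded compactX l1_ge0 l1_convex ch.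
have [N hN] := loss_bounded compactX lm1_ge0 lm1_convex ch.
have y1 := payoff_lty l1_ge0 l1_convex c1_ge0 c1_lsc ch hM g1.
have y2 := payoff_lty lm1_ge0 lm1_convex cm1_ge0 cm1_lsc ch hN g2.
have [v Jv vV] : exists2 v : R, J l1 lm1 c1 cm1 h (g1, g2) < v%:E & v%:E < V.
  have Jy : J l1 lm1 c1 cm1 h (g1, g2) < +oo by rewrite JE lte_add_pinfty.
  move: JV Jy; case: (J _ _ _ _ _ _) => [j||]//; case: V => [w||]//.
  - rewrite lte_fin => jw _; exists ((j + w) / 2)%R; rewrite lte_fin; lra.
  - by move=> _ _; exists (j + 1)%R; rewrite ?ltry// lte_fin; lra.
  - by move=> _ _; exists (w - 1)%R; rewrite ?ltNyr// lte_fin; lra.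
  - by move=> _ _; exists 0%R; rewrite ?ltNyr ?ltry.
have [a [b [ga gb abv]]] := lte_split y1 y2 Jv.
have Ua := payoff_weak_limit l1_ge0 l1_convex c1_ge0 c1_lsc ch hM UU nu1 ga.
have Ub := payoff_weak_limit lm1_ge0 lm1_convex cm1_ge0 cm1_lsc ch hN UU nu2 gb.
have Uv := Uabove (h, v) (conj ch vV).
have [g [/= [ag bg] [_ vg]]] := filter_ex (filterI (filterI Ua Ub) Uv).
have := lt_trans vg (lteD ag bg).
by rewrite -EFinD lte_fin ltNge abv.
Qed.

End minimax_equality.

Local Open Scope ereal_scope.

Theorem proposition4p1 (R : realType) (X : pmetricType R)
  (mu1 mum1 : borel_probability R X)
  (l1 lm1 : R -> R) (c1 cm1 : X * X -> \bar R)
  (compactX : compact [set: X])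
  (l1_ge0 : forall t, (0 <= l1 t)%R) (lm1_ge0 : forall t, (0 <= lm1 t)%R)
  (l1_convex : convex_function [set: R^o] l1)
  (lm1_convex : convex_function [set: R^o] lm1)
  (c1_ge0 : forall p, 0 <= c1 p) (cm1_ge0 : forall p, 0 <= cm1 p)
  (c1_lsc : lower_semicontinuous c1) (cm1_lsc : lower_semicontinuous cm1)
  (c1_diag : forall x, c1 (x, x) = 0) (cm1_diag : forall x, cm1 (x, x) = 0) :
  ereal_inf [set ereal_sup [set J l1 lm1 c1 cm1 h gamma
                            | gamma in Delta mu1 mum1] | h in Cfun X] =
  ereal_sup [set ereal_inf [set J l1 lm1 c1 cm1 h gamma | h in Cfun X]
            | gamma in Delta mu1 mum1] /\
  exists2 gamma, Delta mu1 mum1 gamma &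
    ereal_inf [set J l1 lm1 c1 cm1 h gamma | h in Cfun X] =
    ereal_sup [set ereal_inf [set J l1 lm1 c1 cm1 h gamma' | h in Cfun X]
              | gamma' in Delta mu1 mum1].
Proof.
set infsup := (X in X = _ /\ _); set supinf := (X in _ = X /\ _).
have weak_duality : supinf <= infsup.
  apply: ge_ereal_sup => _ [g Dg <-]; apply: le_ereal_inf_tmp => _ [h ch <-].
  apply: (@le_trans _ _ (J l1 lm1 c1 cm1 h g)).
    by apply: ereal_inf_lbound; exists h.
  by apply: ereal_sup_ubound; exists g.
have [g Dg Vg] := maximin_coupling_exists mu1 mum1 compactX l1_ge0 lm1_ge0
  l1_convex lm1_convex c1_ge0 cm1_ge0 c1_lsc cm1_lsc.
have infsup_g : infsup <= ereal_inf [set J l1 lm1 c1 cm1 h g | h in Cfun X].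
  by apply: le_ereal_inf_tmp => _ [h ch <-]; exact: Vg.
have g_supinf : ereal_inf [set J l1 lm1 c1 cm1 h g | h in Cfun X] <= supinf.
  by apply: ereal_sup_ubound; exists g.
split; first by apply/eqP; rewrite eq_le weak_duality (le_trans infsup_g).
by exists g => //; apply/eqP; rewrite eq_le g_supinf (le_trans weak_duality).
Qed.
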